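(* The category $\mathcal V^{\mathcal F}_{fg}$ of finitely generated $\mathcal F$-representations is abelian.
   Context: $\mathcal F$ is the category with objects the finite sets $[k]=\{1,\dots,k\}$, $k\ge 0$, and all functions as morphisms. $\mathcal V$ is the category of finite-dimensional $\mathbb Q$-vector spaces. An $\mathcal F$-representation (also called an $\mathcal F$-module) is a functor $V:\mathcal F\to\mathcal V$; these form the abelian category $\mathcal V^{\mathcal F}$, with kernels and cokernels computed objectwise. For $k\ge0$ let $\otimes^k:\mathcal F\to\mathcal V$ be the functor sending $X$ to the free $\mathbb Q$-vector space on the set of functions $[k]\to X$ (with $\mathcal F$ acting by postcomposition). $V$ is finitely generated if there is a surjection onto $V$ from a finite direct sum of functors $\otimes^{k}$ (various $k$). $\mathcal V^{\mathcal F}_{fg}$ is the full subcategory of $\mathcal V^{\mathcal F}$ on the finitely generated representations. *)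

(* Defs.v *)
From HB Require Import structures.
From mathcomp Require Import all_boot all_order all_algebra.
From mathcomp Require Import boolp.

Set Implicit Arguments.
Unset Strict Implicit.
Unset Printing Implicit Defensive.

Import GRing.Theory.
Local Open Scope ring_scope.

Declare Scope cat_scope.
Delimit Scope cat_scope with cat.

Record category := Category {
  obj :> Type;
  hom : obj -> obj -> Type;
  idm : forall X : obj, hom X X;
  mcomp : forall X Y Z : obj, hom Y Z -> hom X Y -> hom X Z;
  mcomp1m : forall (X Y : obj) (f : hom X Y), mcomp (idm Y) f = f;
  mcompm1 : forall (X Y : obj) (f : hom X Y), mcomp f (idm X) = f;
  mcompA : forall (X Y Z T : obj) (h : hom Z T) (g : hom Y Z) (f : hom X Y),
    mcomp h (mcomp g f) = mcomp (mcomp h g) f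
}.
Arguments hom {c} X Y.
Arguments idm {c} X.
Arguments mcomp {c X Y Z} g f.

Notation "g ∘ f" := (mcomp g f) (at level 40, left associativity) : cat_scope.
Local Open Scope cat_scope.

Record functor (C D : category) := Functor {
  fobj :> C -> D;
  fmap : forall X Y : C, hom X Y -> hom (fobj X) (fobj Y);
  fmap1 : forall X : C, fmap (idm X) = idm (fobj X);
  fmapM : forall (X Y Z : C) (g : hom Y Z) (f : hom X Y),
    fmap (g ∘ f) = fmap g ∘ fmap f
}.
Arguments fmap {C D} F {X Y} f : rename.

Record nat_trans (C D : category) (F G : functor C D) := NatTrans {
  component :> forall X : C, hom (F X) (G X);
  naturality : forall (X Y : C) (f : hom X Y),
    component Y ∘ fmap F f = fmap G f ∘ component X
}.

Lemma nat_trans_ext (C D : category) (F G : functor C D)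
    (s t : nat_trans F G) : (forall X, s X = t X) -> s = t.
Proof.
case: s t => [s sN] [t tN] /= st.
have E : s = t by apply: functional_extensionality_dep.
by rewrite -{}E in tN *; congr NatTrans; exact: Prop_irrelevance.
Qed.

Section FunctorCategory.
Variables C D : category.

Lemma nt_id_nat (F : functor C D) (X Y : C) (f : hom X Y) :
  idm (F Y) ∘ fmap F f = fmap F f ∘ idm (F X).
Proof. by rewrite mcomp1m mcompm1. Qed.

Definition nt_id (F : functor C D) : nat_trans F F := NatTrans (@nt_id_nat F).

Lemma nt_comp_nat (F G H : functor C D) (t : nat_trans G H) (s : nat_trans F G)
    (X Y : C) (f : hom X Y) :
  (t Y ∘ s Y) ∘ fmap F f = fmap H f ∘ (t X ∘ s X).
Proof. by rewrite -mcompA naturality !mcompA naturality. Qed.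

Definition nt_comp (F G H : functor C D) (t : nat_trans G H)
  (s : nat_trans F G) : nat_trans F H := NatTrans (nt_comp_nat t s).

Definition functor_cat : category.
Proof.
refine (@Category (functor C D) (@nat_trans C D) nt_id nt_comp _ _ _).
- by move=> F G s; apply: nat_trans_ext => X; exact: mcomp1m.
- by move=> F G s; apply: nat_trans_ext => X; exact: mcompm1.
- by move=> F G H K u t s; apply: nat_trans_ext => X; exact: mcompA.
Defined.

End FunctorCategory.

Definition full_subcat (C : category) (P : C -> Prop) : category :=
  @Category {X : C | P X} (fun X Y => hom (sval X) (sval Y))
    (fun X => idm (sval X)) (fun X Y Z g f => g ∘ f)
    (fun X Y => @mcomp1m C (sval X) (sval Y))
    (fun X Y => @mcompm1 C (sval X) (sval Y))
    (fun X Y Z T => @mcompA C (sval X) (sval Y) (sval Z) (sval T)).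

Record preadditive (C : category) := Preadditive {
  madd : forall X Y : C, hom X Y -> hom X Y -> hom X Y;
  mzero : forall X Y : C, hom X Y;
  mopp : forall X Y : C, hom X Y -> hom X Y;
  maddA : forall X Y : C, associative (@madd X Y);
  maddC : forall X Y : C, commutative (@madd X Y);
  madd0 : forall X Y : C, left_id (mzero X Y) (@madd X Y);
  maddN : forall X Y : C, left_inverse (mzero X Y) (@mopp X Y) (@madd X Y);
  mcompDl : forall (X Y Z : C) (g h : hom Y Z) (f : hom X Y),
    madd g h ∘ f = madd (g ∘ f) (h ∘ f);
  mcompDr : forall (X Y Z : C) (g : hom Y Z) (f h : hom X Y),
    g ∘ madd f h = madd (g ∘ f) (g ∘ h)
}.
Arguments madd {C} A {X Y} f g : rename.
Arguments mzero {C} A X Y : rename.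

Section Abelian.
Variable C : category.

Definition mono (X Y : C) (f : hom X Y) : Prop :=
  forall (T : C) (g h : hom T X), f ∘ g = f ∘ h -> g = h.

Definition epi (X Y : C) (f : hom X Y) : Prop :=
  forall (T : C) (g h : hom Y T), g ∘ f = h ∘ f -> g = h.

Definition zero_object (Z : C) : Prop :=
  (forall X : C, exists! f : hom X Z, True) /\
  (forall X : C, exists! f : hom Z X, True).

Variable A : preadditive C.

Definition is_biproduct (X Y B : C) (i1 : hom X B) (i2 : hom Y B)
    (p1 : hom B X) (p2 : hom B Y) : Prop :=
  [/\ p1 ∘ i1 = idm X, p2 ∘ i2 = idm Y,
      p1 ∘ i2 = mzero A Y X, p2 ∘ i1 = mzero A X Y &
      madd A (i1 ∘ p1) (i2 ∘ p2) = idm B].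

Definition is_kernel (X Y K : C) (f : hom X Y) (k : hom K X) : Prop :=
  f ∘ k = mzero A K Y /\
  forall (T : C) (g : hom T X), f ∘ g = mzero A T Y ->
    exists! h : hom T K, k ∘ h = g.

Definition is_cokernel (X Y Q : C) (f : hom X Y) (q : hom Y Q) : Prop :=
  q ∘ f = mzero A X Q /\
  forall (T : C) (g : hom Y T), g ∘ f = mzero A X T ->
    exists! h : hom Q T, h ∘ q = g.

Record abelian_preadditive : Prop := AbelianPreadditive {
  has_zero_object : exists Z : C, zero_object Z;
  has_biproducts : forall X Y : C,
    exists (B : C) (i1 : hom X B) (i2 : hom Y B) (p1 : hom B X) (p2 : hom B Y),
      is_biproduct i1 i2 p1 p2;
  has_kernels : forall (X Y : C) (f : hom X Y),
    exists (K : C) (k : hom K X), is_kernel f k;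
  has_cokernels : forall (X Y : C) (f : hom X Y),
    exists (Q : C) (q : hom Y Q), is_cokernel f q;
  mono_normal : forall (X Y : C) (f : hom X Y), mono f ->
    exists (Z : C) (g : hom Y Z), is_kernel g f;
  epi_normal : forall (X Y : C) (f : hom X Y), epi f ->
    exists (Z : C) (g : hom Z X), is_cokernel g f
}.

End Abelian.

(* A preadditive structure admitting binary biproducts is determined by the
   underlying category, so the existential makes no choice. *)
Definition abelian_category (C : category) : Prop :=
  exists A : preadditive C, abelian_preadditive A.

(* The object k : nat stands for the set [k], realized as 'I_k. *)
Definition ffcomp (k m n : nat) (g : {ffun 'I_m -> 'I_n})
  (f : {ffun 'I_k -> 'I_m}) : {ffun 'I_k -> 'I_n} := [ffun i => g (f i)].

Definition ffid (n : nat) : {ffun 'I_n -> 'I_n} := [ffun i => i].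

Lemma ffcomp1f (m n : nat) (f : {ffun 'I_m -> 'I_n}) : ffcomp (ffid n) f = f.
Proof. by apply/ffunP => i; rewrite !ffunE. Qed.

Lemma ffcompf1 (m n : nat) (f : {ffun 'I_m -> 'I_n}) : ffcomp f (ffid m) = f.
Proof. by apply/ffunP => i; rewrite !ffunE. Qed.

Lemma ffcompA (k m n p : nat) (h : {ffun 'I_n -> 'I_p})
    (g : {ffun 'I_m -> 'I_n}) (f : {ffun 'I_k -> 'I_m}) :
  ffcomp h (ffcomp g f) = ffcomp (ffcomp h g) f.
Proof. by apply/ffunP => i; rewrite !ffunE. Qed.

Definition FinF : category :=
  @Category nat (fun m n => {ffun 'I_m -> 'I_n}) ffid ffcomp
    ffcomp1f ffcompf1 ffcompA.

Definition VectQ : category :=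
  @Category (vectType rat) (fun U V => 'Hom(U, V)) (fun U => \1%VF)
    (fun U V W g f => (g \o f)%VF)
    (fun U V => @comp_lfun1l rat U V) (fun U V => @comp_lfun1r rat U V)
    (fun U V W T => @comp_lfunA rat U V W T).

Definition FRep : category := functor_cat FinF VectQ.

Definition freeQ (S : finType) : vectType rat := {ffun S -> rat^o}.

Definition free_basis (S : finType) (s : S) : freeQ S :=
  [ffun t => (t == s)%:R].

Definition free_map_fun (S T : finType) (g : S -> T) (u : freeQ S) : freeQ T :=
  \sum_(s : S) (u s : rat) *: free_basis (g s).

Definition free_map (S T : finType) (g : S -> T) : 'Hom(freeQ S, freeQ T) :=
  linfun (free_map_fun g).

Lemma free_map_fun_is_linear (S T : finType) (g : S -> T) :
  linear (free_map_fun g).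
Proof.
move=> a u v; rewrite /free_map_fun scaler_sumr -big_split /=.
by apply: eq_bigr => s _; rewrite !ffunE scalerDl scalerA.
Qed.

HB.instance Definition _ (S T : finType) (g : S -> T) :=
  GRing.isLinear.Build rat (freeQ S) (freeQ T) _ (free_map_fun g)
    (free_map_fun_is_linear g).

Lemma free_mapE (S T : finType) (g : S -> T) (u : freeQ S) :
  free_map g u = \sum_(s : S) (u s : rat) *: free_basis (g s).
Proof. by rewrite lfunE. Qed.

Lemma free_basis_sum (S : finType) (u : freeQ S) :
  \sum_(s : S) (u s : rat) *: free_basis s = u.
Proof.
apply/ffunP => t; rewrite sum_ffunE (bigD1 t) //= !ffunE eqxx.
rewrite big1 ?addr0 => [|s st]; first exact: mulr1.
by rewrite !ffunE eq_sym (negPf st); exact: mulr0.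
Qed.

Lemma free_map_basis (S T : finType) (g : S -> T) (s : S) :
  free_map g (free_basis s) = free_basis (g s).
Proof.
rewrite free_mapE (bigD1 s) //= ffunE eqxx scale1r big1 ?addr0 // => t ts.
by rewrite ffunE (negPf ts) scale0r.
Qed.

Section Tensor.
Variable k : nat.

Definition tensor_obj (n : nat) : vectType rat := freeQ {ffun 'I_k -> 'I_n}.

Definition tensor_map (m n : nat) (f : {ffun 'I_m -> 'I_n}) :
    'Hom(tensor_obj m, tensor_obj n) :=
  free_map (fun a : {ffun 'I_k -> 'I_m} => ffcomp f a).

Lemma tensor_map1 (n : nat) : tensor_map (ffid n) = \1%VF.
Proof.
apply/lfunP => u; rewrite id_lfunE free_mapE -[RHS]free_basis_sum.
by apply: eq_bigr => a _; rewrite ffcomp1f.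
Qed.

Lemma tensor_mapM (l m n : nat) (g : {ffun 'I_m -> 'I_n})
    (f : {ffun 'I_l -> 'I_m}) :
  tensor_map (ffcomp g f) = (tensor_map g \o tensor_map f)%VF.
Proof.
apply/lfunP => u; rewrite comp_lfunE [in RHS]/tensor_map !(free_mapE _ u).
rewrite linear_sum; apply: eq_bigr => a _.
by rewrite linearZ /= free_map_basis ffcompA.
Qed.

Definition tensor : FRep := @Functor FinF VectQ tensor_obj tensor_map
  tensor_map1 tensor_mapM.

End Tensor.

Section DirectSum.
Variables V W : functor FinF VectQ.

Definition dsum_obj (n : nat) : vectType rat :=
  ((V n : vectType rat) * (W n : vectType rat))%type.

Definition dsum_map_fun (m n : nat) (f : {ffun 'I_m -> 'I_n})
    (p : dsum_obj m) : dsum_obj n :=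
  ((fmap V f : 'Hom(V m, V n)) p.1, (fmap W f : 'Hom(W m, W n)) p.2).

Lemma dsum_map_fun_is_linear (m n : nat) (f : {ffun 'I_m -> 'I_n}) :
  linear (dsum_map_fun f).
Proof. by move=> a p q; rewrite /dsum_map_fun /= !linearP. Qed.

HB.instance Definition _ (m n : nat) (f : {ffun 'I_m -> 'I_n}) :=
  GRing.isLinear.Build rat (dsum_obj m) (dsum_obj n) _ (dsum_map_fun f)
    (dsum_map_fun_is_linear f).

Definition dsum_map (m n : nat) (f : {ffun 'I_m -> 'I_n}) :
  'Hom(dsum_obj m, dsum_obj n) := linfun (dsum_map_fun f).

Lemma dsum_map1 (n : nat) : dsum_map (ffid n) = \1%VF.
Proof.
apply/lfunP => -[v w]; rewrite id_lfunE lfunE /= /dsum_map_fun.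
by rewrite (@fmap1 _ _ V n) (@fmap1 _ _ W n) !id_lfunE.
Qed.

Lemma dsum_mapM (l m n : nat) (g : {ffun 'I_m -> 'I_n})
    (f : {ffun 'I_l -> 'I_m}) :
  dsum_map (ffcomp g f) = (dsum_map g \o dsum_map f)%VF.
Proof.
apply/lfunP => -[v w]; rewrite comp_lfunE !lfunE /= /dsum_map_fun.
by rewrite (@fmapM _ _ V _ _ _ g f) (@fmapM _ _ W _ _ _ g f) !comp_lfunE.
Qed.

Definition dsum : FRep := @Functor FinF VectQ dsum_obj dsum_map
  dsum_map1 dsum_mapM.

End DirectSum.

Definition zero_rep : FRep :=
  @Functor FinF VectQ (fun _ => 'rV[rat]_0) (fun _ _ _ => \1%VF)
    (fun _ => erefl) (fun _ _ _ _ _ => esym (comp_lfun1l _)).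

Definition tensor_sum (ks : seq nat) : FRep :=
  foldr (fun k (V : FRep) => dsum (tensor k) V) zero_rep ks.

Definition surjection (V W : FRep) (p : hom V W) : Prop :=
  forall n : nat, limg (component p n : 'Hom(_, _)) = fullv.

Definition finitely_generated (V : FRep) : Prop :=
  exists (ks : seq nat) (p : hom (tensor_sum ks) V), surjection p.

Definition FRep_fg : category := full_subcat finitely_generated.

(* Main.v *)
From HB Require Import structures.
From mathcomp Require Import all_boot all_algebra.
Require Import Defs.

(** Kernels, cokernels and finite sums of representations are computed level by
    level, and a pointwise injection (surjection) is the kernel of its cokernel
    (cokernel of its kernel).  All of this restricts to the finitely generated
    representations as soon as they are closed under these constructions.
    Quotients and sums raise no difficulty; the point is that a
    subrepresentation of a finitely generated representation is finitely
    generated.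

    The reason is an identity between endomorphisms.  For a point c of [n] and
    a set S of points, let f_T, for T a subset of S, be the map that sends T
    to c and fixes everything else.  Say that V has degree at most d if
      sum over T in the powerset of S of (-1)^|T| V(f_T) = 0
    whenever S has more than d points.  The functor of k-tuples has degree at
    most k: a function a from [k] misses a point s of S, and then f_T o a does
    not change when s is added to T, so the terms cancel in pairs
    ([tensor_degree_le]).  The condition visibly passes to subobjects,
    quotients and finite sums, so every subquotient of a finite sum of tuple
    functors has bounded degree.

    Conversely, let V have degree at most d and n >= d + 2.  Take S to be all
    points but c.  The term of T empty is the identity of V(n), and for T
    nonempty f_T is not surjective, so it factors through [n - 1].  Hence every
    vector of V(n) is a combination of images of vectors of V(n - 1), and V is
    generated by the finitely many finite-dimensional spaces V(m) with
    m <= d + 1 ([degree_le_fg]).  So finite generation is the same as bounded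
    degree, a condition that subobjects inherit. *)

Set Implicit Arguments.
Unset Strict Implicit.
Unset Printing Implicit Defensive.

Import GRing.Theory.
Local Open Scope ring_scope.
Local Open Scope cat_scope.

(** * Representations as families of linear maps *)

(** [act] and [at_level] present the maps of a representation and the components
    of a morphism as elements of a linear Hom space, which is the form that the
    linear algebra lemmas recognize. *)
Definition act (V : FRep) (m n : nat) (f : {ffun 'I_m -> 'I_n}) :
  'Hom(V m, V n) := fmap V f.

Definition at_level (V W : FRep) (p : hom V W) (n : nat) : 'Hom(V n, W n) :=
  component p n.

Lemma act1 (V : FRep) (n : nat) (v : V n : vectType rat) :
  act V (ffid n) v = v.
Proof. by have := @fmap1 _ _ V n; rewrite /act => ->; rewrite id_lfunE. Qed.

Lemma actM (V : FRep) (l m n : nat) (g : {ffun 'I_m -> 'I_n})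
    (f : {ffun 'I_l -> 'I_m}) (v : V l : vectType rat) :
  act V (ffcomp g f) v = act V g (act V f v).
Proof.
by have := @fmapM _ _ V _ _ _ g f; rewrite /act => ->; rewrite comp_lfunE.
Qed.

Lemma at_level_act (V W : FRep) (p : hom V W) (m n : nat)
    (f : {ffun 'I_m -> 'I_n}) (v : V m : vectType rat) :
  at_level p n (act V f v) = act W f (at_level p m v).
Proof.
have /lfunP/(_ v) := @naturality _ _ _ _ p m n f.
by rewrite [LHS]comp_lfunE [RHS]comp_lfunE.
Qed.

Lemma hom_eqP (V W : FRep) (p q : hom V W) :
  (forall n v, at_level p n v = at_level q n v) -> p = q.
Proof. by move=> pq; apply: nat_trans_ext => n; apply/lfunP => v; apply: pq. Qed.

Lemma at_level_comp (U V W : FRep) (q : hom V W) (p : hom U V) (n : nat)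
    (v : U n : vectType rat) :
  at_level (q ∘ p) n v = at_level q n (at_level p n v).
Proof. exact: comp_lfunE. Qed.

Section HomOfFamily.
Variables (V W : FRep) (p : forall n, 'Hom(V n, W n)).
Hypothesis p_act : forall m n (f : {ffun 'I_m -> 'I_n}) v,
  p n (act V f v) = act W f (p m v).

Lemma family_natural (m n : FinF) (f : hom m n) :
  (p n : hom (V n) (W n)) ∘ fmap V f = fmap W f ∘ (p m : hom (V m) (W m)).
Proof.
by apply/lfunP => v; rewrite [LHS]comp_lfunE [RHS]comp_lfunE; apply: p_act.
Qed.

Definition family_hom : hom V W := NatTrans family_natural.

Lemma hom_of_family : exists q : hom V W, forall n, at_level q n = p n.
Proof. by exists family_hom. Qed.

End HomOfFamily.

Lemma hom_of_linear (V W : FRep)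
    (p : forall n, (V n : vectType rat) -> (W n : vectType rat)) :
  (forall n, linear (p n)) ->
  (forall m n (f : {ffun 'I_m -> 'I_n}) v,
     p n (act V f v) = act W f (p m v)) ->
  exists q : hom V W, forall n v, at_level q n v = p n v.
Proof.
move=> p_lin pN.
pose pL n := GRing.isLinear.Build _ _ _ _ (p n) (p_lin n).
pose pl n : {linear (V n : vectType rat) -> (W n : vectType rat)} :=
  HB.pack (p n) (pL n).
have plE n v : linfun (pl n) v = p n v by rewrite lfunE.
have [m n f v|q qE] := @hom_of_family V W (fun n => linfun (pl n)).
  by rewrite !plE pN.
by exists q => n v; rewrite qE.
Qed.

(** * Subrepresentations and quotients *)

(** Subrepresentations and quotients are built at once: in both cases each new
    space K n is a linear retract of V n, and the action is transported along
    the retraction.  The retraction need not be natural; functoriality only asks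
    that the projection i o r between two consecutive maps be harmless, which
    holds when the image of i is stable, and also when the kernel of r is. *)
Section Retract.
Variables (V : FRep) (K : nat -> vectType rat).
Variables (i : forall n, 'Hom(K n, V n)) (r : forall n, 'Hom(V n, K n)).
Hypothesis iK : forall n, cancel (i n) (r n).

Definition retract_act (m n : nat) (f : {ffun 'I_m -> 'I_n}) : 'Hom(K m, K n) :=
  (r n \o act V f \o i m)%VF.

Hypothesis retract_compat : forall l m n (g : {ffun 'I_m -> 'I_n})
    (f : {ffun 'I_l -> 'I_m}) (v : K l),
  r n (act V g (i m (r m (act V f (i l v))))) = r n (act V g (act V f (i l v))).

Lemma retract_act1 (n : nat) : retract_act (ffid n) = \1%VF.
Proof. by apply/lfunP => v; rewrite !comp_lfunE /= act1 iK id_lfunE. Qed.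

Lemma retract_actM (l m n : nat) (g : {ffun 'I_m -> 'I_n})
    (f : {ffun 'I_l -> 'I_m}) :
  retract_act (ffcomp g f) = (retract_act g \o retract_act f)%VF.
Proof.
by apply/lfunP => v; rewrite !comp_lfunE /= actM retract_compat.
Qed.

Definition retract_rep : FRep :=
  @Functor FinF VectQ K retract_act retract_act1 retract_actM.

Lemma act_retract (m n : nat) (f : {ffun 'I_m -> 'I_n}) (v : K m) :
  act retract_rep f v = r n (act V f (i m v)).
Proof. by rewrite -[LHS]/(retract_act f v) !comp_lfunE. Qed.

End Retract.

Lemma subrep_exists (V : FRep) (U : forall n, {vspace V n}) :
  (forall m n (f : {ffun 'I_m -> 'I_n}) v, v \in U m -> act V f v \in U n) ->
  exists (K : FRep) (k : hom K V), forall n,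
    injective (at_level k n) /\ limg (at_level k n) = U n.
Proof.
move=> stab.
pose K n : vectType rat := subvs_of (U n).
pose i n : 'Hom(K n, V n) := linfun (@vsval _ _ (U n)).
pose r n : 'Hom(V n, K n) := linfun (@vsproj _ _ (U n)).
have iE n v : i n v = vsval v by rewrite lfunE.
have iK n : cancel (i n) (r n) by move=> v; rewrite !lfunE; apply: vsvalK.
have rK n v : v \in U n -> i n (r n v) = v.
  by move=> Uv; rewrite !lfunE; apply: vsprojK.
have Ui n v : i n v \in U n by rewrite iE subvsP.
have compat l m n (g : {ffun 'I_m -> 'I_n}) (f : {ffun 'I_l -> 'I_m}) v :
    r n (act V g (i m (r m (act V f (i l v))))) = r n (act V g (act V f (i l v))).
  by rewrite rK // stab ?Ui.
have [m n f v|k kE] := @hom_of_family (retract_rep iK compat) V i.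
  by rewrite act_retract rK // stab ?Ui.
exists (retract_rep iK compat), k => n; rewrite kE; split.
  exact: can_inj (iK n).
apply/vspaceP => v; apply/idP/idP => [/memv_imgP[w _ ->]|/rK <-]; first exact: Ui.
exact: memv_img (memvf _).
Qed.

(** The quotient by U is realized on the image of the idempotent e = 1 - projv U,
    a linear complement of U: e itself is then the quotient map. *)
Lemma quotrep_exists (V : FRep) (U : forall n, {vspace V n}) :
  (forall m n (f : {ffun 'I_m -> 'I_n}) v, v \in U m -> act V f v \in U n) ->
  exists (Q : FRep) (q : hom V Q), forall n,
    limg (at_level q n) = fullv /\ lker (at_level q n) = U n.
Proof.
move=> stab.
pose e n : 'Hom(V n, V n) := (\1 - projv (U n))%VF.
have eE n v : e n v = v - projv (U n) v by rewrite !lfunE /= opp_lfunE id_lfunE.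
have eU n v : v - e n v \in U n by rewrite eE subKr memv_proj.
have e0 n v : v \in U n -> e n v = 0 by move=> Uv; rewrite eE projv_id ?subrr.
pose Q n : vectType rat := subvs_of (limg (e n)).
pose i n : 'Hom(Q n, V n) := linfun (@vsval _ _ (limg (e n))).
pose r n : 'Hom(V n, Q n) := (linfun (@vsproj _ _ (limg (e n))) \o e n)%VF.
have rE n v : i n (r n v) = e n v.
  rewrite lfunE /= [X in vsval X]comp_lfunE [X in vsval X]lfunE vsprojK //.
  exact: memv_img (memvf _).
have i_inj n : injective (i n).
  by move=> u v; rewrite !lfunE; apply: subvs_inj.
have iK n : cancel (i n) (r n).
  move=> v; apply: i_inj; rewrite rE.
  have /memv_imgP[w _ ->] : i n v \in limg (e n) by rewrite lfunE subvsP.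
  apply/eqP; rewrite -subr_eq0 -linearB -opprB linearN oppr_eq0.
  exact/eqP/e0/eU.
have rU n v : v \in U n -> r n v = 0.
  by move=> Uv; apply: i_inj; rewrite rE e0 ?linear0.
have compat' m n (g : {ffun 'I_m -> 'I_n}) v :
    r n (act V g (i m (r m v))) = r n (act V g v).
  apply/eqP; rewrite rE -subr_eq0 -!linearB -opprB !linearN oppr_eq0.
  exact/eqP/rU/stab/eU.
have compat l m n (g : {ffun 'I_m -> 'I_n}) (f : {ffun 'I_l -> 'I_m}) v :
    r n (act V g (i m (r m (act V f (i l v))))) = r n (act V g (act V f (i l v))).
  exact: compat'.
have [m n f v|q qE] := @hom_of_family V (retract_rep iK compat) r.
  by rewrite act_retract compat'.
exists (retract_rep iK compat), q => n; rewrite qE; split.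
  apply/eqP; rewrite eqEsubv subvf /=; apply/subvP => v _.
  by rewrite -(iK n v) memv_img ?memvf.
apply/vspaceP => v; rewrite memv_ker; apply/eqP/idP => [rv0|/rU//].
by have := eU n v; rewrite -rE rv0 linear0 subr0.
Qed.

(** * Direct sums *)

Lemma act_dsum (V W : FRep) (m n : nat) (f : {ffun 'I_m -> 'I_n})
    (x : dsum V W m : vectType rat) :
  act (dsum V W) f x = (act V f x.1, act W f x.2).
Proof. exact: lfunE. Qed.

Lemma dsum_structure (V W : FRep) :
  exists (i1 : hom V (dsum V W)) (i2 : hom W (dsum V W))
         (p1 : hom (dsum V W) V) (p2 : hom (dsum V W) W),
  [/\ forall n v, at_level i1 n v = (v, 0), forall n w, at_level i2 n w = (0, w),
      forall n x, at_level p1 n x = x.1 & forall n x, at_level p2 n x = x.2].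
Proof.
have [n c u v|m n f v|i1 i1E] :=
    @hom_of_linear V (dsum V W) (fun n v => (v, 0)).
- by congr (_, _); rewrite /= scaler0 addr0.
- by rewrite act_dsum linear0.
have [n c u v|m n f v|i2 i2E] :=
    @hom_of_linear W (dsum V W) (fun n w => (0, w)).
- by congr (_, _); rewrite /= scaler0 addr0.
- by rewrite act_dsum linear0.
have [//|m n f v|p1 p1E] := @hom_of_linear (dsum V W) V (fun n x => x.1).
  by rewrite act_dsum.
have [//|m n f v|p2 p2E] := @hom_of_linear (dsum V W) W (fun n x => x.2).
  by rewrite act_dsum.
by exists i1, i2, p1, p2; split.
Qed.

Lemma dsum_copair (V W X : FRep) (f : hom V X) (g : hom W X) :
  exists h : hom (dsum V W) X, forall n x,
    at_level h n x = at_level f n x.1 + at_level g n x.2.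
Proof.
have [n c x y|m n k x|h hE] := @hom_of_linear (dsum V W) X
    (fun n x => at_level f n x.1 + at_level g n x.2).
- by rewrite !linearP scalerDr addrACA.
- by rewrite act_dsum !at_level_act linearD.
by exists h.
Qed.

(** * Representations of bounded degree *)

Definition collapse (n : nat) (c : 'I_n) (T : {set 'I_n}) :
  {ffun 'I_n -> 'I_n} := [ffun i => if i \in T then c else i].

(** The alternating sum is the inclusion-exclusion difference of V along the
    points of S. *)
Definition cross_diff (V : FRep) (n : nat) (c : 'I_n) (S : {set 'I_n})
  (v : V n : vectType rat) : (V n : vectType rat) :=
  \sum_(T in powerset S) (-1) ^+ #|T| *: act V (collapse c T) v.

Definition degree_le (d : nat) (V : FRep) : Prop :=
  forall n (c : 'I_n) (S : {set 'I_n}) (v : V n : vectType rat),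
    (d < #|S|)%N -> cross_diff c S v = 0.

Lemma cross_diff_nat (V W : FRep) (p : hom V W) (n : nat) (c : 'I_n)
    (S : {set 'I_n}) (v : V n : vectType rat) :
  at_level p n (cross_diff c S v) = cross_diff c S (at_level p n v).
Proof.
rewrite linear_sum; apply: eq_bigr => T _.
by rewrite linearZ /= at_level_act.
Qed.

(** The defining identity lives in V n and is natural in V, so it can be checked
    after an injection; dually it descends along a surjection. *)
Lemma degree_le_inj (d : nat) (V W : FRep) (p : hom V W) :
  (forall n, injective (at_level p n)) -> degree_le d W -> degree_le d V.
Proof.
move=> p_inj dW n c S v dS; apply: p_inj.
by rewrite cross_diff_nat dW // linear0.
Qed.

Lemma degree_le_surj (d : nat) (V W : FRep) (p : hom V W) :
  surjection p -> degree_le d V -> degree_le d W.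
Proof.
move=> p_surj dV n c S w dS.
have /memv_imgP[v _ ->] : w \in limg (at_level p n) by rewrite p_surj memvf.
by rewrite -[LHS]cross_diff_nat dV // linear0.
Qed.

(** Subsets that contain s cancel against those that do not, through adding s. *)
Lemma alternating_sum0 (I : finType) (U : lmodType rat) (S : {set I}) (s : I)
    (F : {set I} -> U) :
  s \in S -> (forall T, F (s |: T) = F T) ->
  \sum_(T in powerset S) (-1) ^+ #|T| *: F T = 0.
Proof.
move=> Ss Fs; rewrite (bigID (fun T : {set I} => s \in T)) /=.
rewrite (reindex_onto (fun T => s |: T) (fun T => T :\ s)) /=; last first.
  by move=> T /andP[_ /setD1K].
have sTE (T : {set I}) : ((s |: T) :\ s == T) = (s \notin T).
  by apply/eqP/idP => [<-|/setU1K //]; rewrite !inE eqxx.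
rewrite addrC; apply/eqP; rewrite addr_eq0 -sumrN; apply/eqP/eq_big => T.
  by rewrite !inE eqxx sTE subUset sub1set Ss /= andbT.
by move=> /andP[_ sT]; rewrite cardsU1 sT exprS mulN1r scaleNr opprK Fs.
Qed.

(** A k-tuple misses a point s of S when S has more than k points; collapsing s
    or not makes no difference to that tuple. *)
Lemma tensor_degree_le (k : nat) : degree_le k (tensor k).
Proof.
move=> n c S; rewrite -[forall v, _]/(forall u : tensor_obj k n, _) => u kS.
have basis0 (a : {ffun 'I_k -> 'I_n}) :
    cross_diff c S (free_basis a : tensor k n : vectType rat) = 0.
  have [s Ss sa] : exists2 s, s \in S & s \notin codom a.
    apply/subsetPn; apply: contraL kS => /subset_leq_card Sa; rewrite -leqNgt.
    by rewrite (leq_trans Sa) // (leq_trans (leq_image_card _ _)) ?card_ord.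
  apply: (alternating_sum0 Ss) => T.
  rewrite /act /= /tensor_map !free_map_basis; congr free_basis.
  apply/ffunP => i; rewrite !ffunE !inE; case: eqP => //= ais.
  by rewrite -ais codom_f in sa.
rewrite -(free_basis_sum u) /cross_diff.
under eq_bigr => T _ do rewrite linear_sum scaler_sumr.
rewrite exchange_big big1 //= => a _.
under eq_bigr => T _ do rewrite linearZ scalerA mulrC -scalerA.
by rewrite -scaler_sumr [X in _ *: X]basis0 scaler0.
Qed.

Lemma zero_rep_degree_le (d : nat) : degree_le d zero_rep.
Proof. by move=> n c S v _; rewrite [LHS]thinmx0 [RHS]thinmx0. Qed.

Lemma dsum_degree_le (d e : nat) (V W : FRep) :
  degree_le d V -> degree_le e W -> degree_le (maxn d e) (dsum V W).
Proof.
move=> dV eW n c S x; rewrite gtn_max => /andP[dS eS].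
have [_ [_ [p1 [p2 [_ _ p1E p2E]]]]] := dsum_structure V W.
apply/eqP; rewrite -pair_eqE; apply/andP; split; apply/eqP.
  by rewrite -[LHS]p1E cross_diff_nat dV.
by rewrite -[LHS]p2E cross_diff_nat eW.
Qed.

Lemma tensor_sum_degree_le (ks : seq nat) :
  exists d, degree_le d (tensor_sum ks).
Proof.
elim: ks => [|k ks [d dks]]; first by exists 0%N; apply: zero_rep_degree_le.
by exists (maxn k d); apply: dsum_degree_le => //; apply: tensor_degree_le.
Qed.

Lemma fg_degree_le (V : FRep) :
  finitely_generated V -> exists d, degree_le d V.
Proof.
move=> [ks [p p_surj]]; have [d dks] := tensor_sum_degree_le ks.
by exists d; apply: degree_le_surj p_surj dks.
Qed.

(** * Bounded degree is finite generation *)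

(** A vector v of V m is the image of the tautological tuple under the morphism
    that sends a tuple a to V(a) v. *)
Section Yoneda.
Variables (V : FRep) (m : nat) (v : V m : vectType rat).

Definition yoneda_fun (n : nat) (u : tensor_obj m n) : (V n : vectType rat) :=
  \sum_(a : {ffun 'I_m -> 'I_n}) (u a : rat) *: act V a v.

Lemma yoneda_fun_is_linear (n : nat) : linear (@yoneda_fun n).
Proof.
move=> c u w; rewrite /yoneda_fun scaler_sumr -big_split.
by apply: eq_bigr => a _ /=; rewrite !ffunE scalerDl scalerA.
Qed.

HB.instance Definition _ (n : nat) :=
  GRing.isLinear.Build rat (tensor_obj m n) (V n) _ (@yoneda_fun n)
    (@yoneda_fun_is_linear n).

Lemma yoneda_fun_basis (n : nat) (a : {ffun 'I_m -> 'I_n}) :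
  yoneda_fun (free_basis a) = act V a v.
Proof.
rewrite /yoneda_fun (bigD1 a) //= ffunE eqxx scale1r big1 ?addr0 // => b ba.
by rewrite ffunE (negPf ba) scale0r.
Qed.

Lemma yoneda :
  exists (p : hom (tensor m) V) (u : tensor m m : vectType rat),
    at_level p m u = v.
Proof.
have [n|l n f u|q qE] := @hom_of_linear (tensor m) V yoneda_fun.
- exact: yoneda_fun_is_linear.
- rewrite [act _ _ _]free_mapE !linear_sum; apply: eq_bigr => a _.
  by rewrite !linearZ /= yoneda_fun_basis actM.
by exists q, (free_basis (ffid m)); rewrite qE yoneda_fun_basis act1.
Qed.

End Yoneda.

(** The generators only grow, so adding them one vector and one level at a time
    keeps the levels that are already covered. *)
Lemma add_generator (V : FRep) (ks : seq nat) (p : hom (tensor_sum ks) V)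
    (m : nat) (v : V m : vectType rat) :
  exists (ls : seq nat) (q : hom (tensor_sum ls) V),
    (forall n, limg (at_level p n) <= limg (at_level q n))%VS /\
    v \in limg (at_level q m).
Proof.
have [f [u fu]] := yoneda v; have [h hE] := dsum_copair f p.
exists (m :: ks), h; split=> [n|].
  apply/subvP => _ /memv_imgP[w _ ->].
  have -> : at_level p n w = at_level h n (0, w) by rewrite hE linear0 add0r.
  exact: memv_img (memvf _).
have -> : v = at_level h m (u, 0) by rewrite hE linear0 addr0.
exact: memv_img (memvf _).
Qed.

Lemma add_generators (V : FRep) (ks : seq nat) (p : hom (tensor_sum ks) V)
    (m : nat) (vs : seq (V m : vectType rat)) :
  exists (ls : seq nat) (q : hom (tensor_sum ls) V),
    (forall n, limg (at_level p n) <= limg (at_level q n))%VS /\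
    {subset vs <= limg (at_level q m)}.
Proof.
elim: vs => [|v vs [ls [q [pq vsq]]]]; first by exists ks, p; split.
have [ls' [q' [qq' vq']]] := add_generator q v.
exists ls', q'; split=> [n|w]; first exact: subv_trans (pq n) (qq' n).
by rewrite inE => /predU1P[-> //|/vsq]; apply/subvP.
Qed.

Lemma generated_below (V : FRep) (N : nat) :
  exists (ks : seq nat) (p : hom (tensor_sum ks) V),
    forall n, (n < N)%N -> limg (at_level p n) = fullv.
Proof.
elim: N => [|N [ks [p p_surj]]].
  have [p _] : exists p : hom zero_rep V, forall n, at_level p n = 0.
    by apply: hom_of_family => m n f v; rewrite !zero_lfunE linear0.
  by exists [::], p.
have [ls [q [pq Nq]]] := add_generators p (vbasis (fullv : {vspace V N})).
exists ls, q => n; rewrite ltnS leq_eqVlt => /predU1P[->|nN].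
  apply/eqP; rewrite eqEsubv subvf /=.
  by rewrite -(span_basis (vbasisP fullv)); apply/span_subvP.
by apply/eqP; rewrite eqEsubv subvf -(p_surj n nN) pq.
Qed.

(** The collapse misses every point s of T, because c is not in T; so it factors
    through the complement of s, which [lift s] identifies with 'I_n. *)
Lemma collapse_factor (n : nat) (T : {set 'I_n.+1}) :
  T != set0 -> ord_max \notin T ->
  exists (g : {ffun 'I_n -> 'I_n.+1}) (h : {ffun 'I_n.+1 -> 'I_n}),
    collapse ord_max T = ffcomp g h.
Proof.
move=> /set0Pn[s sT] maxT.
pose c : 'I_n.+1 := ord_max.
have cs : s != c by apply: contraNneq maxT => sc; rewrite -/c -sc.
have [c' cE] := unlift_some cs.
(* No value of the collapse equals s, so [unlift s] is defined on all of them. *)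
exists [ffun i => lift s i].
exists [ffun i => odflt c' (unlift s (if i \in T then c else i))].
apply/ffunP => i; rewrite !ffunE.
set j := if _ then _ else _.
have sj : s != j.
  by rewrite /j; case: ifP => // iT; apply: contraFneq iT => <-.
by have [k jE kE] := unlift_some sj; rewrite [unlift s j]kE.
Qed.

(** Above level d + 1 the identity of V n is a combination of maps that factor
    through the previous level, so nothing new is needed there. *)
Lemma degree_le_fg (d : nat) (V : FRep) :
  degree_le d V -> finitely_generated V.
Proof.
move=> dV; have [ks [p p_surj]] := generated_below V d.+2.
exists ks, p; elim=> [|n IHn]; first exact: p_surj.
have [/p_surj //|dn] := ltnP n.+1 d.+2.
apply/eqP; rewrite eqEsubv subvf /=; apply/subvP => v _.
pose c : 'I_n.+1 := ord_max; pose S := [set~ c].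
have dS : (d < #|S|)%N by rewrite cardsC1 card_ord.
have := dV _ c S v dS; rewrite /cross_diff (bigD1 set0) ?inE ?sub0set //=.
have -> : collapse c set0 = ffid n.+1 by apply/ffunP => i; rewrite !ffunE inE.
(* The term of the empty set is v; the others move to the right-hand side. *)
rewrite cards0 expr0 scale1r act1 => /eqP; rewrite addr_eq0 => /eqP ->.
rewrite memvN; apply: memv_suml => T /andP[]; rewrite inE => TS T0.
have [|g [h ->]] := collapse_factor T0.
  by apply/negP => /(subsetP TS); rewrite !inE eqxx.
apply: memvZ; rewrite actM.
have /memv_imgP[u _ ->] : act V h v \in limg (at_level p n) by rewrite IHn memvf.
by rewrite -at_level_act; apply: memv_img (memvf _).
Qed.

(** * Additive structure, kernels and cokernels *)

Section Additive.
Variables V W : FRep.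

Lemma hom_add_act (p q : hom V W) m n (f : {ffun 'I_m -> 'I_n}) v :
  (at_level p n + at_level q n)%VF (act V f v) =
  act W f ((at_level p m + at_level q m)%VF v).
Proof. by rewrite !add_lfunE !at_level_act linearD. Qed.

Lemma hom_opp_act (p : hom V W) m n (f : {ffun 'I_m -> 'I_n}) v :
  (- at_level p n)%VF (act V f v) = act W f ((- at_level p m)%VF v).
Proof. by rewrite !opp_lfunE at_level_act linearN. Qed.

Lemma hom_zero_act m n (f : {ffun 'I_m -> 'I_n}) v :
  (0 : 'Hom(V n, W n)) (act V f v) = act W f ((0 : 'Hom(V m, W m)) v).
Proof. by rewrite !zero_lfunE linear0. Qed.

Definition hom_add (p q : hom V W) : hom V W := family_hom (hom_add_act p q).
Definition hom_opp (p : hom V W) : hom V W := family_hom (hom_opp_act p).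
Definition hom_zero : hom V W := family_hom hom_zero_act.

Lemma at_level_add (p q : hom V W) n v :
  at_level (hom_add p q) n v = at_level p n v + at_level q n v.
Proof. exact: add_lfunE. Qed.

Lemma at_level_opp (p : hom V W) n v :
  at_level (hom_opp p) n v = - at_level p n v.
Proof. exact: opp_lfunE. Qed.

Lemma at_level_zero n v : at_level hom_zero n v = 0.
Proof. exact: zero_lfunE. Qed.

End Additive.

Definition FRep_preadditive : preadditive FRep.
Proof.
refine (@Preadditive FRep hom_add hom_zero hom_opp _ _ _ _ _ _).
- by move=> V W p q r; apply: hom_eqP => n v; rewrite !at_level_add addrA.
- by move=> V W p q; apply: hom_eqP => n v; rewrite !at_level_add addrC.
- move=> V W p; apply: hom_eqP => n v.
  by rewrite at_level_add at_level_zero add0r.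
- move=> V W p; apply: hom_eqP => n v.
  by rewrite at_level_add at_level_opp at_level_zero addNr.
- move=> U V W p q r; apply: hom_eqP => n v.
  by rewrite !(at_level_add, at_level_comp).
- move=> U V W p q r; apply: hom_eqP => n v.
  by rewrite !(at_level_add, at_level_comp) linearD.
Defined.

Definition full_preadditive (C : category) (P : C -> Prop) (A : preadditive C) :
    preadditive (full_subcat P) :=
  @Preadditive (full_subcat P) (fun X Y => @madd C A (sval X) (sval Y))
    (fun X Y => mzero A (sval X) (sval Y))
    (fun X Y => @mopp C A (sval X) (sval Y))
    (fun X Y => @maddA C A (sval X) (sval Y))
    (fun X Y => @maddC C A (sval X) (sval Y))
    (fun X Y => @madd0 C A (sval X) (sval Y))
    (fun X Y => @maddN C A (sval X) (sval Y))
    (fun X Y Z => @mcompDl C A (sval X) (sval Y) (sval Z))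
    (fun X Y Z => @mcompDr C A (sval X) (sval Y) (sval Z)).

Section Full.
Variables (C : category) (P : C -> Prop) (A : preadditive C).

Lemma full_is_kernel (X Y K : full_subcat P) (f : hom X Y) (k : hom K X) :
  is_kernel A (f : @hom C (sval X) (sval Y)) (k : @hom C (sval K) (sval X)) ->
  is_kernel (full_preadditive P A) f k.
Proof. by move=> [fk kU]; split=> // T; apply: kU. Qed.

Lemma full_is_cokernel (X Y Q : full_subcat P) (f : hom X Y) (q : hom Y Q) :
  is_cokernel A (f : @hom C (sval X) (sval Y)) (q : @hom C (sval Y) (sval Q)) ->
  is_cokernel (full_preadditive P A) f q.
Proof. by move=> [qf qU]; split=> // T; apply: qU. Qed.

End Full.

Lemma comp_eq0P (U V W : FRep) (p : hom U V) (q : hom V W) :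
  q ∘ p = mzero FRep_preadditive U W <->
  forall n, (limg (at_level p n) <= lker (at_level q n))%VS.
Proof.
split=> [qp n|qp].
  apply/subvP => _ /memv_imgP[u _ ->].
  by rewrite memv_ker -at_level_comp qp at_level_zero.
apply: hom_eqP => n u; rewrite at_level_comp at_level_zero; apply/eqP.
by rewrite -memv_ker (subvP (qp n)) // memv_img ?memvf.
Qed.

(** The factorization through k is k^-1 o g, where k^-1 is any linear left
    inverse; it is natural because k is injective and k^-1 undoes k on the
    image of g. *)
Lemma levelwise_kernel (V W K : FRep) (f : hom V W) (k : hom K V) :
  (forall n, injective (at_level k n)) ->
  (forall n, limg (at_level k n) = lker (at_level f n)) ->
  is_kernel FRep_preadditive f k.
Proof.
move=> k_inj kf; split; first by apply/comp_eq0P => n; rewrite kf.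
move=> T g /comp_eq0P fg.
have kK n v : at_level k n ((at_level k n)^-1%VF (at_level g n v)) = at_level g n v.
  apply: limg_lfunVK; rewrite kf (subvP (fg n)) //; exact: memv_img (memvf _).
have [m n a v|h hE] :=
    @hom_of_family T K (fun n => (at_level k n)^-1 \o at_level g n)%VF.
  by apply: k_inj; rewrite !comp_lfunE at_level_act !kK at_level_act.
exists h; split=> [|h' kh'].
  by apply: hom_eqP => n v; rewrite at_level_comp hE comp_lfunE kK.
apply: hom_eqP => n v; apply: k_inj; rewrite hE comp_lfunE kK.
by rewrite -kh' at_level_comp.
Qed.

(** Dually, g factors as (g o q^-1) o q with q^-1 a linear section of q; the
    choice does not matter since g kills the kernel of q. *)
Lemma levelwise_cokernel (V W Q : FRep) (f : hom V W) (q : hom W Q) :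
  (forall n, limg (at_level q n) = fullv) ->
  (forall n, lker (at_level q n) = limg (at_level f n)) ->
  is_cokernel FRep_preadditive f q.
Proof.
move=> q_surj qf; split; first by apply/comp_eq0P => n; rewrite qf.
move=> T g /comp_eq0P gf.
have qK n x : at_level q n ((at_level q n)^-1%VF x) = x.
  by apply: limg_lfunVK; rewrite q_surj memvf.
have gK n v : at_level g n ((at_level q n)^-1%VF (at_level q n v)) = at_level g n v.
  apply/eqP; rewrite -subr_eq0 -linearB -memv_ker (subvP (gf n)) //.
  by rewrite -qf memv_ker linearB /= qK subrr.
have [m n a x|h hE] :=
    @hom_of_family Q T (fun n => at_level g n \o (at_level q n)^-1)%VF.
  by rewrite !comp_lfunE -at_level_act -[x in LHS]qK -at_level_act gK.
exists h; split=> [|h' hq'].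
  by apply: hom_eqP => n v; rewrite at_level_comp hE comp_lfunE gK.
apply: hom_eqP => n x; rewrite hE comp_lfunE -hq' at_level_comp.
by rewrite qK.
Qed.

Lemma kernel_exists (V W : FRep) (f : hom V W) :
  exists (K : FRep) (k : hom K V), forall n,
    injective (at_level k n) /\ limg (at_level k n) = lker (at_level f n).
Proof.
apply: subrep_exists => m n a v; rewrite !memv_ker at_level_act => /eqP ->.
by rewrite linear0.
Qed.

Lemma cokernel_exists (V W : FRep) (f : hom V W) :
  exists (Q : FRep) (q : hom W Q), forall n,
    limg (at_level q n) = fullv /\ lker (at_level q n) = limg (at_level f n).
Proof.
apply: quotrep_exists => m n a _ /memv_imgP[v _ ->].
by rewrite -at_level_act; apply: memv_img (memvf _).
Qed.

(** * The abelian category of finitely generated representations *)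

(** The noetherian property: finite generation amounts to bounded degree, which
    subobjects inherit. *)
Lemma fg_sub (V W : FRep) (p : hom V W) :
  (forall n, injective (at_level p n)) ->
  finitely_generated W -> finitely_generated V.
Proof.
move=> p_inj /fg_degree_le[d dW].
by apply: (@degree_le_fg d); apply: degree_le_inj p_inj dW.
Qed.

Lemma fg_quot (V W : FRep) (p : hom V W) :
  (forall n, limg (at_level p n) = fullv) ->
  finitely_generated V -> finitely_generated W.
Proof.
move=> p_surj /fg_degree_le[d dV].
by apply: (@degree_le_fg d); apply: degree_le_surj p_surj dV.
Qed.

Lemma fg_dsum (V W : FRep) :
  finitely_generated V -> finitely_generated W ->
  finitely_generated (dsum V W).
Proof.
move=> /fg_degree_le[d dV] /fg_degree_le[e eW].
by apply: (@degree_le_fg (maxn d e)); apply: dsum_degree_le.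
Qed.

Lemma fg_zero : finitely_generated zero_rep.
Proof. by apply: (@degree_le_fg 0); apply: zero_rep_degree_le. Qed.

Definition FRep_fg_preadditive : preadditive FRep_fg :=
  full_preadditive finitely_generated FRep_preadditive.

Lemma fg_kernel (X Y : FRep_fg) (f : hom X Y) :
  exists (K : FRep_fg) (k : hom K X), is_kernel FRep_fg_preadditive f k /\
    forall n, limg (at_level k n) = lker (at_level f n).
Proof.
have [K [k kP]] := @kernel_exists (sval X) (sval Y) f.
have Kfg : finitely_generated K.
  by apply: (fg_sub (p := k)) (svalP X) => n; case: (kP n).
exists (exist _ K Kfg), k; split=> [|n]; last by case: (kP n).
by apply: full_is_kernel; apply: levelwise_kernel => n; case: (kP n).
Qed.

Lemma fg_cokernel (X Y : FRep_fg) (f : hom X Y) :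
  exists (Q : FRep_fg) (q : hom Y Q), is_cokernel FRep_fg_preadditive f q /\
    forall n, limg (at_level q n) = fullv /\
              lker (at_level q n) = limg (at_level f n).
Proof.
have [Q [q qP]] := @cokernel_exists (sval X) (sval Y) f.
have Qfg : finitely_generated Q.
  by apply: (fg_quot (p := q)) (svalP Y) => n; case: (qP n).
exists (exist _ Q Qfg), q; split=> [|//].
by apply: full_is_cokernel; apply: levelwise_cokernel => n; case: (qP n).
Qed.

(** The kernel must itself be finitely generated for a monomorphism of the full
    subcategory to cancel its inclusion. *)
Lemma mono_injective (X Y : FRep_fg) (f : hom X Y) :
  mono f -> forall n, injective (at_level f n).
Proof.
move=> f_mono n; have [K [k [[fk _] kf]]] := fg_kernel f.
have k0 : k = mzero FRep_fg_preadditive K X.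
  apply: f_mono; rewrite fk; apply: (@hom_eqP (sval K) (sval Y)) => m v.
  by rewrite at_level_comp !at_level_zero linear0.
apply/lker0P; rewrite -kf k0 -subv0; apply/subvP => _ /memv_imgP[v _ ->].
by rewrite at_level_zero mem0v.
Qed.

Lemma epi_surjective (X Y : FRep_fg) (f : hom X Y) :
  epi f -> forall n, limg (at_level f n) = fullv.
Proof.
move=> f_epi n; have [Q [q [[qf _] qP]]] := fg_cokernel f.
have q0 : q = mzero FRep_fg_preadditive Y Q.
  apply: f_epi; rewrite qf; apply: (@hom_eqP (sval X) (sval Q)) => m v.
  by rewrite at_level_comp !at_level_zero.
have [_ <-] := qP n; rewrite q0; apply/vspaceP => v.
by rewrite memv_ker at_level_zero eqxx memvf.
Qed.

Theorem theorem4p16 : abelian_category FRep_fg.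
Proof.
exists FRep_fg_preadditive; split.
- have uniq0 (V W : FRep) : (forall p q : hom V W, p = q) ->
      exists! f : hom V W, True.
    by move=> pq; exists (hom_zero V W); split.
  exists (exist _ zero_rep fg_zero); split=> -[V fgV]; apply: uniq0 => p q.
    by apply: hom_eqP => n v; rewrite [LHS]thinmx0 [RHS]thinmx0.
  by apply: hom_eqP => n v; rewrite [v]thinmx0 !linear0.
- move=> [V fgV] [W fgW].
  have [i1 [i2 [p1 [p2 [i1E i2E p1E p2E]]]]] := dsum_structure V W.
  exists (exist _ (dsum V W) (fg_dsum fgV fgW)), i1, i2, p1, p2.
  split; apply: hom_eqP => n v.
  + by rewrite at_level_comp i1E p1E [RHS]id_lfunE.
  + by rewrite at_level_comp i2E p2E [RHS]id_lfunE.
  + by rewrite at_level_comp i2E p1E at_level_zero.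
  + by rewrite at_level_comp i1E p2E at_level_zero.
  + rewrite at_level_add !at_level_comp i1E i2E p1E p2E [RHS]id_lfunE.
    by rewrite [RHS]surjective_pairing; congr (_, _); rewrite /= ?addr0 ?add0r.
- by move=> X Y f; have [K [k [kf _]]] := fg_kernel f; exists K, k.
- by move=> X Y f; have [Q [q [qf _]]] := fg_cokernel f; exists Q, q.
- move=> X Y f /mono_injective f_inj; have [Q [q [_ qP]]] := fg_cokernel f.
  exists Q, q; apply: full_is_kernel; apply: levelwise_kernel => // n.
  by case: (qP n).
move=> X Y f /epi_surjective f_surj; have [K [k [_ kf]]] := fg_kernel f.
by exists K, k; apply: full_is_cokernel; apply: levelwise_cokernel.
Qed.
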